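(* Let $n\neq -1,0$ and $\mu$ be real constants with $\mu\neq-\frac{n+2}{n}$, and put $\lambda=\frac{3n+4-n\mu-2\mu}{\mu n+n+2}$. The point transformation $$x'=\frac{2n+2}{\mu n+n+2}\,x^{\frac{\mu n+n+2}{2n+2}},\qquad t'=t,\qquad u'=x^{\frac{\mu-1}{n+1}}u$$ maps the equation $$u'_{t'}=\left({u'}^nu'_{x'}\right)_{x'}+\lambda\frac{{u'}^n}{x'}u'_{x'}$$ into the equation $$u_t=\left(u^nu_x\right)_x+\frac{\mu}{x}u^nu_x .$$
   Context: Subscripts denote partial derivatives. A point transformation $x'=P(x,t)$, $t'=Q(t)$, $u'=R(x,t,u)$ ''maps an equation $E'$ for $u'(x',t')$ into an equation $E$ for $u(x,t)$'' if: whenever $(x,t)\mapsto(P(x,t),Q(t))$ is a diffeomorphism of an open set $D\subset\{x>0\}$ onto an open set $D'$, $u$ is a smooth positive function on $D$, and $u'$ is defined on $D'$ by $u'(P(x,t),Q(t))=R(x,t,u(x,t))$, then $u'$ satisfies $E'$ on $D'$ if and only if $u$ satisfies $E$ on $D$. *)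

(* Defs.v *)
(* Stdlib reals with Coquelicot. *)
From Stdlib Require Export Reals.
From Coquelicot Require Export Coquelicot.

Open Scope R_scope.

(* A function on a subset D of the plane is represented by a total function
   R -> R -> R of which only the values on D matter; D is always open below,
   so partial derivatives at points of D depend only on these values. *)

(* C^oo on the open set D: Coquelicot's [ex_diff_n f k x y] says that all
   iterated partial derivatives up to order k exist and are continuous at
   (x, y). *)
Definition smooth_on (D : R * R -> Prop) (f : R -> R -> R) : Prop :=
  forall x y : R, D (x, y) -> forall k : nat, ex_diff_n f k x y.

(* (x, y) |-> (F x y, G x y) is a C^oo diffeomorphism of D onto D';
   (F', G') is the inverse map. *)
Definition diffeomorphism (D D' : R * R -> Prop) (F G : R -> R -> R) : Prop :=
  smooth_on D F /\ smooth_on D G /\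
  (forall x y, D (x, y) -> D' (F x y, G x y)) /\
  exists F' G' : R -> R -> R,
    smooth_on D' F' /\ smooth_on D' G' /\
    (forall x' y', D' (x', y') -> D (F' x' y', G' x' y')) /\
    (forall x y, D (x, y) ->
       F' (F x y) (G x y) = x /\ G' (F x y) (G x y) = y) /\
    (forall x' y', D' (x', y') ->
       F (F' x' y') (G' x' y') = x' /\ G (F' x' y') (G' x' y') = y').

(* An equation for one unknown function of (x, t), given by its solution
   predicate: [E D u] means that u satisfies the equation on D. *)
Definition equation : Type := (R * R -> Prop) -> (R -> R -> R) -> Prop.

(* The point transformation x' = P(x,t), t' = Q(t), u' = S(x,t,u) maps the
   equation E' for u'(x',t') into the equation E for u(x,t), the functions u
   being smooth and positive on open sets D of the half-plane x > 0. *)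
Definition maps_equation (P : R -> R -> R) (Q : R -> R) (S : R -> R -> R -> R)
    (E' E : equation) : Prop :=
  forall (D D' : R * R -> Prop) (u u' : R -> R -> R),
    open D -> (forall x t, D (x, t) -> 0 < x) -> open D' ->
    diffeomorphism D D' P (fun _ t => Q t) ->
    smooth_on D u -> (forall x t, D (x, t) -> 0 < u x t) ->
    (forall x t, D (x, t) -> u' (P x t) (Q t) = S x t (u x t)) ->
    (E' D' u' <-> E D u).

(* u_t = (u^n u_x)_x + (m / x) u^n u_x on D.  Since [Derive] is total, the
   existence of every derivative occurring in the equation is required
   explicitly.  [Rpower] is the intended real power at positive arguments. *)
Definition diffusion_equation (n m : R) : equation := fun D u =>
  forall x t : R, D (x, t) ->
    let flux := fun y => Rpower (u y t) n * Derive (fun z => u z t) y in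
    ex_derive (fun s => u x s) t /\
    ex_derive (fun z => u z t) x /\
    ex_derive flux x /\
    Derive (fun s => u x s) t
    = Derive flux x
      + m / x * Rpower (u x t) n * Derive (fun z => u z t) x.

(* Main.v *)
Require Import Defs.
From Stdlib Require Import Lra.

(** Put [k = (mu n + n + 2) / (2 n + 2)] and [a = (mu - 1) / (n + 1)], so that
    [x' = x^k / k] and [u' = x^a u].  Since [k = 1 + n a / 2], one has
    [dx'/dx = x^(k-1) = x^(n a / 2)], and the chain rule gives

      [u'_x' = x^(a - n a / 2) (u_x + a u / x)],
      [u'^n u'_x' = x^(a + n a / 2) (phi + a u^(n+1) / x)],
        where [phi = u^n u_x],
      [(u'^n u'_x')_x' + lambda u'^n u'_x' / x'
         = x^a (phi_x + ((n + 1) a + c) phi / x + a (c - 1) u^(n+1) / x^2)],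
        where [c = (n / 2 + 1) a + lambda k].

    The value of [lambda] is the one for which [c = 1]: the term in [u^(n+1)]
    vanishes and the coefficient of [phi / x] becomes [(n + 1) a + 1 = mu].  As
    [u'_t' = x^a u_t], the two equations differ at corresponding points by the
    nonzero factor [x^a], whence the equivalence.

    The function [u'] is only known through the relation [u'(x', t) = x^a u(x, t)],
    so its derivatives in [x'] have to be shown to exist.  [is_derive_through_power]
    does this by writing a function of [x'] as a function of [x] composed with
    the explicit local inverse [x = (k x')^(1/k)].  It is applied once to [u'],
    at all points near a given one, and once to the flux [u'^n u'_x']
    ([is_derive_transformed] and [is_derive_transformed_flux]). *)

(** * Powers and the change of the space variable *)

Lemma Rpower_pos (x c : R) : 0 < Rpower x c.
Proof. apply exp_pos. Qed.

Lemma is_derive_Rpower (c x : R) :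
  0 < x -> is_derive (fun y => Rpower y c) x (c * Rpower x c / x).
Proof.
  intros Hx. unfold Rpower. auto_derive; [exact Hx | field; lra].
Qed.

Lemma Rpower_minus_1 (x c : R) : 0 < x -> Rpower x (c - 1) = Rpower x c / x.
Proof.
  intros Hx. unfold Rminus, Rdiv.
  rewrite Rpower_plus, Rpower_Ropp, Rpower_1; auto.
Qed.

Definition power_change (k x : R) : R := / k * Rpower x k.

Definition power_change_inv (k y : R) : R := Rpower (k * y) (/ k).

Lemma power_change_scaled (k x : R) :
  k <> 0 -> k * power_change k x = Rpower x k.
Proof. intros Hk. unfold power_change. field. exact Hk. Qed.

Lemma power_change_invK (k x : R) :
  k <> 0 -> 0 < x -> power_change_inv k (power_change k x) = x.
Proof.
  intros Hk Hx. unfold power_change_inv.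
  rewrite power_change_scaled, Rpower_mult, Rinv_r, Rpower_1; auto.
Qed.

Lemma power_changeK (k y : R) :
  k <> 0 -> 0 < k * y -> power_change k (power_change_inv k y) = y.
Proof.
  intros Hk Hy. unfold power_change, power_change_inv.
  rewrite Rpower_mult, Rinv_l, Rpower_1; auto. field. exact Hk.
Qed.

Lemma is_derive_power_change_inv (k x : R) :
  k <> 0 -> 0 < x ->
  is_derive (power_change_inv k) (power_change k x) (/ Rpower x (k - 1)).
Proof.
  intros Hk Hx.
  assert (Hp := Rpower_pos x k).
  assert (Hs := power_change_scaled k x Hk).
  assert (Hd : is_derive (power_change_inv k) (power_change k x)
     (k * (/ k * Rpower (k * power_change k x) (/ k) / (k * power_change k x)))).
  { apply (is_derive_comp (fun z => Rpower z (/ k)) (fun y => k * y)).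
    - apply is_derive_Rpower. rewrite Hs. exact Hp.
    - auto_derive; [exact I | ring]. }
  fold (power_change_inv k (power_change k x)) in Hd.
  rewrite power_change_invK, Hs in Hd by assumption.
  rewrite Rpower_minus_1 by assumption.
  replace (/ (Rpower x k / x)) with (k * (/ k * x / Rpower x k)); [exact Hd |].
  field. repeat split; lra.
Qed.

(** Near [power_change k x] the function [f] coincides with
    [fun y => h (power_change_inv k y)], because the inverse is continuous and so
    takes its values in the neighbourhood of [x] on which the relation between
    [f] and [h] holds. *)
Lemma is_derive_through_power (k x l : R) (f h : R -> R) :
  k <> 0 -> 0 < x ->
  locally x (fun z => f (power_change k z) = h z) ->
  is_derive h x l ->
  is_derive f (power_change k x) (l / Rpower x (k - 1)).
Proof.
  intros Hk Hx Hloc Hh.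
  assert (Hinv := is_derive_power_change_inv k x Hk Hx).
  assert (Hcont : continuous (power_change_inv k) (power_change k x)).
  { apply (ex_derive_continuous (power_change_inv k)). eexists. exact Hinv. }
  assert (Hpos : locally (power_change k x) (fun y => 0 < k * y)).
  { assert (Hc : continuous (fun y => k * y) (power_change k x)).
    { apply (ex_derive_continuous (fun y => k * y)). auto_derive. exact I. }
    apply (Hc (fun z => 0 < z)). apply (open_gt 0).
    rewrite power_change_scaled by exact Hk. apply Rpower_pos. }
  apply (is_derive_ext_loc (fun y => h (power_change_inv k y))).
  - rewrite <- (power_change_invK k x Hk Hx) in Hloc.
    specialize (Hcont _ Hloc). unfold filtermap in Hcont.
    generalize (filter_and _ _ Hcont Hpos). apply filter_imp.
    intros y [Hy Hky].
    rewrite <- Hy, power_changeK by assumption. reflexivity.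
  - replace (l / Rpower x (k - 1)) with (scal (/ Rpower x (k - 1)) l)
      by (unfold scal; simpl; unfold mult; simpl; unfold Rdiv; ring).
    apply (is_derive_comp h (power_change_inv k)); [| exact Hinv].
    rewrite power_change_invK by assumption. exact Hh.
Qed.

(** * Transformation of the gradient and of the flux *)

Definition flux (n : R) (v : R -> R) (z : R) : R := Rpower (v z) n * Derive v z.

Lemma is_derive_transformed (a k x : R) (v w : R -> R) :
  k <> 0 -> 0 < x -> ex_derive v x ->
  locally x (fun z => w (power_change k z) = Rpower z a * v z) ->
  is_derive w (power_change k x)
    (Rpower x a / Rpower x (k - 1) * (Derive v x + a * v x / x)).
Proof.
  intros Hk Hx Hv Hw.
  replace (Rpower x a / Rpower x (k - 1) * (Derive v x + a * v x / x))
    with ((a * Rpower x a / x * v x + Rpower x a * Derive v x)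
          / Rpower x (k - 1))
    by (field; split; [lra | apply Rgt_not_eq, Rpower_pos]).
  apply is_derive_through_power with (h := fun z => Rpower z a * v z);
    try assumption.
  apply (is_derive_mult (fun z => Rpower z a) v).
  - apply is_derive_Rpower. exact Hx.
  - apply Derive_correct. exact Hv.
  - intros; apply Rmult_comm.
Qed.

Lemma ex_derive_flux (n x : R) (v : R -> R) :
  0 < v x -> ex_derive v x -> ex_derive (Derive v) x -> ex_derive (flux n v) x.
Proof.
  intros Hp Hv Hv2. unfold flux, Rpower.
  apply (ex_derive_mult (fun z => exp (n * ln (v z))) (Derive v));
    [auto_derive; auto | exact Hv2].
Qed.

(** The exponent condition [k = 1 + n a / 2] makes both powers of [x] below
    simplify: [x^(n a) x^a / x^(k-1) = x^a x^(k-1)]. *)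
Lemma transformed_flux (n a k x : R) (v w : R -> R) :
  k = 1 + n * a / 2 -> k <> 0 -> 0 < x -> 0 < v x -> ex_derive v x ->
  locally x (fun z => w (power_change k z) = Rpower z a * v z) ->
  flux n w (power_change k x)
  = Rpower x (a + (k - 1)) * (flux n v x + a * (Rpower (v x) n * v x) / x).
Proof.
  intros Ek Hk Hx Hp Hv Hw. unfold flux.
  rewrite (is_derive_unique _ _ _ (is_derive_transformed a k x v w Hk Hx Hv Hw)).
  rewrite (locally_singleton _ _ Hw).
  rewrite <- Rpower_mult_distr by (exact Hp || apply Rpower_pos).
  rewrite Rpower_mult, Rpower_plus.
  replace (a * n) with ((k - 1) + (k - 1)) by (rewrite Ek; field).
  rewrite Rpower_plus. field. split; [lra | apply Rgt_not_eq, Rpower_pos].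
Qed.

(** Besides the product rule this uses
    [(u^(n+1) / x)_x = (n + 1) phi / x - u^(n+1) / x^2] and
    [a + (k - 1) = (n / 2 + 1) a]; dividing by [dx'/dx = x^(k-1)] leaves the
    common factor [x^a]. *)
Lemma is_derive_transformed_flux (n a k x : R) (v w : R -> R) :
  k = 1 + n * a / 2 -> k <> 0 -> 0 < x ->
  locally x (fun z => 0 < v z) -> locally x (ex_derive v) ->
  ex_derive (Derive v) x ->
  locally x (fun z => w (power_change k z) = Rpower z a * v z) ->
  is_derive (flux n w) (power_change k x)
    (Rpower x a *
      (Derive (flux n v) x
       + ((n + 1) * a + (n / 2 + 1) * a) * flux n v x / x
       + a * ((n / 2 + 1) * a - 1) * (Rpower (v x) n * v x) / x ^ 2)).
Proof.
  intros Ek Hk Hx Hp Hv Hv2 Hw.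
  assert (Hpx := locally_singleton _ _ Hp). simpl in Hpx.
  assert (Hvx := locally_singleton _ _ Hv).
  assert (Hflux := ex_derive_flux n x v Hpx Hvx Hv2).
  set (b := a + (k - 1)).
  set (l := b * Rpower x b / x * (flux n v x + a * (Rpower (v x) n * v x) / x)
     + Rpower x b * (Derive (flux n v) x
         + a * ((n + 1) * flux n v x / x - Rpower (v x) n * v x / x ^ 2))).
  assert (Hl : is_derive
    (fun z => Rpower z b * (flux n v z + a * (Rpower (v z) n * v z) / z)) x l).
  { apply (is_derive_mult (fun z => Rpower z b)
             (fun z => flux n v z + a * (Rpower (v z) n * v z) / z)).
    - apply is_derive_Rpower. exact Hx.
    - apply (is_derive_plus (flux n v) (fun z => a * (Rpower (v z) n * v z) / z)).
      + apply Derive_correct. exact Hflux.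
      + unfold flux, Rpower. auto_derive.
        * repeat split; auto; lra.
        * rewrite (Derive_ext (fun z => v z) v) by reflexivity.
          field. split; lra.
    - intros; apply Rmult_comm. }
  replace (Rpower x a * _) with (l / Rpower x (k - 1)).
  - apply is_derive_through_power with (2 := Hx) (4 := Hl); [exact Hk |].
    (* The formula for the flux holds at every point near [x], since the
       relation between [v] and [w] holds near each of these points. *)
    assert (Hpos : locally x (fun z => 0 < z)) by (apply (open_gt 0); exact Hx).
    generalize (filter_and _ _ (filter_and _ _ Hpos Hp)
                  (filter_and _ _ Hv (locally_locally _ _ Hw))).
    apply filter_imp. intros z [[Hz Hpz] [Hvz Hwz]].
    apply transformed_flux; assumption.
  - unfold l, b. rewrite Rpower_plus.
    assert (Hq := Rpower_pos x (k - 1)).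
    set (q := Rpower x (k - 1)) in *.
    replace (k - 1) with (n * a / 2) by (rewrite Ek; ring).
    field. split; lra.
Qed.

(** * Transformation of the equation at a point *)

Definition diffusion_equation_at (n m : R) (u : R -> R -> R) (x t : R) : Prop :=
  ex_derive (fun s => u x s) t /\
  ex_derive (fun z => u z t) x /\
  ex_derive (flux n (fun z => u z t)) x /\
  Derive (fun s => u x s) t
  = Derive (flux n (fun z => u z t)) x
    + m / x * Rpower (u x t) n * Derive (fun z => u z t) x.

Lemma open_slices (D : R * R -> Prop) (x t : R) :
  open D -> D (x, t) ->
  locally x (fun z => D (z, t)) /\ locally t (fun s => D (x, s)).
Proof.
  intros HD Hxt. destruct (HD _ Hxt) as [e He].
  split; exists e; intros z Hz; apply He; split; simpl;
    (exact Hz || apply ball_center).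
Qed.

(** All derivatives exist on both sides by smoothness of [u], and the difference
    of the two sides of the equation for [u'] is [x^a] times that for [u]; the
    condition on [lambda] says [c = 1] in the computation above. *)
Lemma diffusion_equation_at_transformed
    (n a k mu lambda : R) (D : R * R -> Prop) (u u' : R -> R -> R) (x t : R) :
  k = 1 + n * a / 2 -> k <> 0 -> mu = (n + 1) * a + 1 ->
  lambda * k = 1 - (n / 2 + 1) * a ->
  open D -> (forall x t, D (x, t) -> 0 < x) ->
  smooth_on D u -> (forall x t, D (x, t) -> 0 < u x t) ->
  (forall x t, D (x, t) -> u' (power_change k x) t = Rpower x a * u x t) ->
  D (x, t) ->
  diffusion_equation_at n lambda u' (power_change k x) t
  <-> diffusion_equation_at n mu u x t.
Proof.
  intros Ek Hk Emu El HD Hpos Hs Hu Huu' Hxt.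
  assert (Hx := Hpos _ _ Hxt).
  destruct (open_slices D x t HD Hxt) as [Lx Lt].
  set (v := fun z => u z t). set (w := fun z => u' z t).
  assert (Hp : locally x (fun z => 0 < v z)).
  { revert Lx. apply filter_imp. intros z Hz. apply Hu. exact Hz. }
  assert (Hv : locally x (ex_derive v)).
  { revert Lx. apply filter_imp. intros z Hz. apply (Hs _ _ Hz 1%nat). }
  assert (Hw : locally x (fun z => w (power_change k z) = Rpower z a * v z)).
  { revert Lx. apply filter_imp. intros z Hz. apply Huu'. exact Hz. }
  assert (Hv2 : ex_derive (Derive v) x).
  { destruct (Hs _ _ Hxt 2%nat) as (_ & _ & _ & H & _). apply H. }
  assert (Hvx := locally_singleton _ _ Hv).
  assert (Hpx := locally_singleton _ _ Hp). simpl in Hpx.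
  assert (Ht : ex_derive (fun s => u x s) t).
  { apply (Hs _ _ Hxt 1%nat). }
  assert (Ht' : is_derive (fun s => u' (power_change k x) s) t
                  (Rpower x a * Derive (fun s => u x s) t)).
  { apply (is_derive_ext_loc (fun s => Rpower x a * u x s)).
    - revert Lt. apply filter_imp. intros s H. symmetry. apply Huu'. exact H.
    - apply (is_derive_scal (fun s => u x s)). apply Derive_correct. exact Ht. }
  assert (Hw' := is_derive_transformed a k x v w Hk Hx Hvx Hw).
  assert (Hf' := is_derive_transformed_flux n a k x v w Ek Hk Hx Hp Hv Hv2 Hw).
  assert (Hfx := transformed_flux n a k x v w Ek Hk Hx Hpx Hvx Hw).
  assert (Hf := ex_derive_flux n x v Hpx Hvx Hv2).
  assert (Hterm : lambda / power_change k x
      * Rpower (u' (power_change k x) t) n * Derive w (power_change k x)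
    = Rpower x a * (lambda * k)
      * (flux n v x / x + a * (Rpower (v x) n * v x) / x ^ 2)).
  { rewrite Rmult_assoc.
    change (Rpower (u' _ t) n * _) with (flux n w (power_change k x)).
    rewrite Hfx, Rpower_plus, Rpower_minus_1 by exact Hx.
    unfold power_change. field.
    repeat split; try lra. apply Rgt_not_eq, Rpower_pos. }
  assert (Hmu : mu / x * Rpower (u x t) n * Derive v x = mu * flux n v x / x).
  { unfold flux, v. field. lra. }
  unfold diffusion_equation_at. fold v w.
  assert (Et' : Derive (fun s => u' (power_change k x) s) t
    = Rpower x a * Derive (fun s => u x s) t)
    by exact (is_derive_unique _ _ _ Ht').
  rewrite Et', (is_derive_unique _ _ _ Hf'),
    Hterm, Hmu, El, Emu.
  assert (Ha := Rpower_pos x a).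
  match goal with
  | |- (_ /\ _ /\ _ /\ ?A = ?B) <-> (_ /\ _ /\ _ /\ ?A0 = ?B0) =>
      assert (HB : B = Rpower x a * B0) by (field; lra)
  end.
  rewrite HB. split; intros (_ & _ & _ & H); repeat split; auto.
  - apply Rmult_eq_reg_l in H; [exact H | lra].
  - eexists; exact Ht'.
  - eexists; exact Hw'.
  - eexists; exact Hf'.
  - rewrite H. reflexivity.
Qed.

Theorem mainTheorem5 :
  forall n mu lambda : R,
    n <> -1 -> n <> 0 -> mu <> - ((n + 2) / n) ->
    lambda = (3 * n + 4 - n * mu - 2 * mu) / (mu * n + n + 2) ->
    maps_equation
      (fun x t => (2 * n + 2) / (mu * n + n + 2)
                  * Rpower x ((mu * n + n + 2) / (2 * n + 2)))
      (fun t => t)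
      (fun x t u => Rpower x ((mu - 1) / (n + 1)) * u)
      (diffusion_equation n lambda)
      (diffusion_equation n mu).
Proof.
  intros n mu lambda Hn1 Hn0 Hmu Hl.
  assert (Hd : mu * n + n + 2 <> 0).
  { intros H. apply Hmu. replace (n + 2) with (- mu * n) by lra. field. exact Hn0. }
  assert (Hn : n + 1 <> 0) by lra.
  assert (Hn2 : 2 * n + 2 <> 0) by lra.
  set (a := (mu - 1) / (n + 1)). set (k := (mu * n + n + 2) / (2 * n + 2)).
  assert (Ek : k = 1 + n * a / 2) by (unfold k, a; field; split; lra).
  assert (Hk : k <> 0).
  { unfold k, Rdiv. apply Rmult_integral_contrapositive_currified;
      [exact Hd | apply Rinv_neq_0_compat; exact Hn2]. }
  assert (Emu : mu = (n + 1) * a + 1) by (unfold a; field; exact Hn).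
  assert (El : lambda * k = 1 - (n / 2 + 1) * a)
    by (rewrite Hl; unfold k, a; field; repeat split; lra).
  replace ((2 * n + 2) / (mu * n + n + 2)) with (/ k)
    by (unfold k; field; split; assumption).
  intros D D' u u' HD Hpos _ (_ & _ & HDD' & F' & G' & _ & _ & HD'D & _ & HFG)
    Hs Hu Huu'.
  assert (Hat : forall x t, D (x, t) ->
    diffusion_equation_at n lambda u' (power_change k x) t
    <-> diffusion_equation_at n mu u x t).
  { intros x t Hxt.
    apply (diffusion_equation_at_transformed n a k mu lambda D); assumption. }
  split.
  - intros HE x t Hxt. apply Hat; [exact Hxt |].
    exact (HE _ _ (HDD' _ _ Hxt)).
  - intros HE x' t' Hxt'.
    assert (Hxt := HD'D _ _ Hxt').
    assert (HE' := proj2 (Hat _ _ Hxt) (HE _ _ Hxt)).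
    destruct (HFG _ _ Hxt') as [Ex Et].
    change (power_change k (F' x' t') = x') in Ex.
    rewrite Ex, Et in HE'. exact HE'.
Qed.
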